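(* Let $[U,\mathcal K]\subseteq[\mathbb R^n,\mathcal K^\star]$, where $\mathcal K^\star$ is the collection of all convex subsets of $\mathbb R^n$. Consider any $P\in\mathcal K$ such that $P_I:=\operatorname{conv}(P)$ with respect to $\mathbb R^n$ is a full-dimensional polyhedron, and any relaxation $P'$ of $P$. Suppose the family of disjunctions used in branch-and-cut tree certificates includes the simple valid disjunctions $H,H^c$ for any halfspace $H$ in the larger Helly system $[\mathbb R^n,\mathcal K^\star]$. Then $$\text{facet complexity of }P\ \le\ \text{hull complexity of }P\ \le\ f\,(\text{facet complexity of }P+1),$$ where $f$ is the number of facets of $P_I$.
   Context: $[U,\mathcal K]\subseteq[\mathbb R^n,\mathcal K^\star]$ means that $U\subseteq\mathbb R^n$ and $\mathcal K=\{C\cap U:C\subseteq\mathbb R^n\text{ convex}\}$. A relaxation of $K\in\mathcal K$ is a convex set $K'\subseteq\mathbb R^n$ with $K'\cap U=K$ (and $K$ is the restriction of $K'$). A halfspace in $[\mathbb R^n,\mathcal K^\star]$ is a convex set $H\subseteq\mathbb R^n$ whose complement $H^c=\mathbb R^n\setminus H$ is also convex. It is a valid halfspace for $K\in\mathcal K$ if $K\subseteq H\cap U$. A valid disjunction is a finite collection of convex sets $D_1,\dots,D_p\subseteq\mathbb R^n$ with $\bigcup_i(D_i\cap U)=U$. Here $P$ stands for a system $K_1,\dots,K_t\in\mathcal K$ with $P=K_1\cap\dots\cap K_t$, and $P'$ for a system of relaxations $K'_1,\dots,K'_t$ of these sets with $P'=K'_1\cap\dots\cap K'_t$. A certificate of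 infeasibility for a system of sets with empty intersection is a binary string that a fixed checking algorithm accepts in time polynomial in the lengths of the system and the string; every infeasible system has one and no feasible system does. Its size is its length. A branch-and-cut tree is a rooted tree in which each node has two labels. The first label is a list $\mathcal L$ of convex sets in $\mathbb R^n$. The second label of an internal node with list $\mathcal L$ is either (a) a valid disjunction $D_1,\dots,D_p$, in which case the node has $p$ children with first labels $\mathcal L\cup\{D_i\}$; or (b) a valid halfspace $G'$ for the intersection of $U$ with all sets in $\mathcal L$, in which case the node has two children: the right child has first label $\mathcal L\cup\{G'\}$, and the left child is a leaf, called a cutting plane certifier, whose second label is a certificate of infeasibility (possibly itself a branch-and-cut certificate) for the system consisting of the restrictions of the sets in $\mathcal L$ together with $U\setminus G'$. The second label of any other leaf may be empty or hold a certificate of infeasibility. The size of the tree is its total number of nodes plus the sum of the sizes of all infeasibility certificates provided at the nodes with valid halfspaces. One can restrict the families of valid disjunctions and of valid halfspaces that may be used; all complexities are relative to this choice, and a complexity is $+\infty$ if no tree of the required kind exists. Complexities are assumed finite for simplicity (in the infinite case the inequalities are regarded as trivial). The hull complexity of $P$ (with respect to $K'_1,\dots,K'_t$) is the smallest size of a branch-and-cut tree whose root has first label $\{K'_1,\dots,K'_t\}$ and such that for every leaf the intersection of the sets in the first label of the leaf is contained in $\operatorname{conv}(P)$. For a valid halfspace $H'$ for $P$, the validity complexity of $H'$ is the smallest size of a branch-and-cut tree whose root has first label $\{K'_1,\dots,K'_t\}$ and such that for every leaf the intersection of the sets in the first label of the leaf is contained in $H'$. The validity complexity of a facet of $\operatorname{conv}(P)$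 is the minimum of the validity complexities of all halfspaces that define that facet. The facet complexity of $P$ (with respect to $P'$) is the maximum validity complexity of all facets of $\operatorname{conv}(P)$.
   Formalization: The formal theorem assumes that adding sets to an infeasible system never forces a longer certificate of infeasibility, and states the upper bound only when the number f of facets is positive; without these the stated upper bound can fail. *)

(* Defs.v *)
From HB Require Import structures.
From mathcomp Require Import all_boot all_order all_algebra.
From mathcomp Require Import all_classical all_reals all_analysis.
Set Implicit Arguments.
Unset Strict Implicit.
Unset Printing Implicit Defensive.
Import Order.TTheory GRing.Theory Num.Theory.
Import numFieldNormedType.Exports.
Local Open Scope classical_set_scope.
Local Open Scope ring_scope.

(* Points of R^n are row vectors. *)

Section Convexity.
Variables (R : realType) (n : nat).
Local Notation V := 'rV[R]_n.

Definition convex (A : set V) : Prop := @convex_set R V A.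

Definition conv_hull (A : set V) : set V := smallest convex A.

(* No closedness is required: open and partially open halfspaces, set0 and
   setT all qualify. *)
Definition halfspace (H : set V) : Prop := convex H /\ convex (~` H).

Definition boundary (A : set V) : set V := closure A `\` interior A.

Definition polyhedron (A : set V) : Prop :=
  exists (m : nat) (M : 'M[R]_(n, m)) (b : 'rV[R]_m),
    A = [set x : V | forall j, (x *m M) ord0 j <= b ord0 j].

Definition affinely_independent (k : nat) (x : 'I_k.+1 -> V) : Prop :=
  row_free (\matrix_(i < k) (x (lift ord0 i) - x ord0)).

Definition full_dimensional (A : set V) : Prop :=
  exists x : 'I_n.+1 -> V, affinely_independent x /\ forall i, A (x i).

Definition face (A F : set V) : Prop :=
  exists (c : 'cV[R]_n) (d : R),
    (forall x, A x -> (x *m c) ord0 ord0 <= d) /\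
    F = A `&` [set x | (x *m c) ord0 ord0 = d].

Definition proper_face (A F : set V) : Prop :=
  [/\ face A F, F !=set0 & F <> A].

Definition facets (A : set V) : set (set V) :=
  [set F | proper_face A F /\
           forall G, proper_face A G -> F `<=` G -> G = F].

End Convexity.

Section HellySystem.
Variables (R : realType) (n : nat).
Local Notation V := 'rV[R]_n.
Variable U : set V.

(* The family K of the system [U, K]. *)
Definition helly_family : set (set V) := [set C `&` U | C in @convex R n].

Definition relaxation (K K' : set V) : Prop := convex K' /\ K' `&` U = K.

Definition valid_halfspace (H K : set V) : Prop :=
  halfspace H /\ K `<=` H `&` U.

Definition valid_disjunction (D : seq (set V)) : Prop :=
  (forall A, A \in D -> convex A) /\
  \big[setU/set0]_(A <- D) (A `&` U) = U.

Definition inter (L : seq (set V)) : set V := \big[setI/setT]_(A <- L) A.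

Definition restrictions (L : seq (set V)) : seq (set V) :=
  [seq A `&` U | A <- L].

(* [accepts S w]: the checking algorithm accepts w as a certificate of
   infeasibility of the system S.  Running times are not modelled. *)
Record checker := Checker {
  accepts : seq (set V) -> seq bool -> bool;
  checker_sound : forall S w, (forall A, A \in S -> helly_family A) ->
    accepts S w -> inter S = set0;
  checker_complete : forall S, (forall A, A \in S -> helly_family A) ->
    inter S = set0 -> exists w, accepts S w }.

(* Enlarging an infeasible system does not make it harder to certify.
   Subtrees are reused below additional disjuncts, which enlarges the systems
   to be certified; an arbitrary sound and complete checker could then demand
   arbitrarily longer certificates. *)
Definition subsystem_monotone (ck : checker) : Prop :=
  forall S S' w, (forall A, A \in S' -> helly_family A) -> subseq S S' ->
    accepts ck S w -> exists2 w', accepts ck S' w' & (size w' <= size w)%N.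

End HellySystem.

(* Only the second labels are stored: first labels are determined by the
   label of the root.  The cutting plane certifier, i.e. the left child of a
   node labelled by the halfspace G, is kept implicit in [Cut]; its second
   label is the certificate w. *)
Inductive bctree (T : Type) : Type :=
| Leaf of option (seq bool)
| Disj (p : nat) of p.-tuple (set T) & ('I_p -> bctree T)
| Cut (G : set T) (w : seq bool) of bctree T.

Arguments Leaf {T} _.
Arguments Disj {T p} _ _.
Arguments Cut {T} _ _ _.

(* A [Cut] node contributes itself, its cutting plane certifier and the
   length of the certificate; certificates at other leaves are not counted. *)
Fixpoint bcsize (T : Type) (t : bctree T) : nat :=
  match t with
  | Leaf _ => 1%N
  | @Disj _ p _ ch => (1 + \sum_(i < p) bcsize (ch i))%N
  | Cut _ w t' => (2 + size w + bcsize t')%N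
  end.

Section BranchAndCut.
Variables (R : realType) (n : nat).
Local Notation V := 'rV[R]_n.
Variables (U : set V) (ck : checker U).
(* The families of disjunctions and of halfspaces allowed in the trees. *)
Variables (disjs : set (seq (set V))) (cuts : set (set V)).

(* [bcvalid L t]: t is a branch-and-cut tree with first label L at the root. *)
Fixpoint bcvalid (L : seq (set V)) (t : bctree V) : Prop :=
  match t with
  | Leaf None => True
  | Leaf (Some w) => accepts ck (restrictions U L) w
  | @Disj _ p D ch =>
      [/\ valid_disjunction U D, disjs D
        & forall i : 'I_p, bcvalid (rcons L (tnth D i)) (ch i)]
  | Cut G w t' =>
      [/\ valid_halfspace U G (U `&` inter L), cuts G,
          accepts ck (rcons (restrictions U L) (U `\` G)) w
        & bcvalid (rcons L G) t']
  end.

(* First labels of the leaves other than cutting plane certifiers. *)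
Fixpoint leaf_labels (L : seq (set V)) (t : bctree V) : set (seq (set V)) :=
  match t with
  | Leaf _ => [set L]
  | @Disj _ p D ch =>
      [set l | exists i : 'I_p, leaf_labels (rcons L (tnth D i)) (ch i) l]
  | Cut G _ t' => leaf_labels (rcons L G) t'
  end.

Local Open Scope ereal_scope.

(* Smallest size of a tree with root label L' all of whose leaves are
   contained in X; +oo if there is none. *)
Definition bc_complexity (L' : seq (set V)) (X : set V) : \bar R :=
  ereal_inf [set ((bcsize t)%:R)%:E | t in
    [set t | bcvalid L' t /\ forall l, leaf_labels L' t l -> inter l `<=` X]].

Definition hull_complexity (P : set V) (L' : seq (set V)) : \bar R :=
  bc_complexity L' (conv_hull P).

Definition validity_complexity (H : set V) (L' : seq (set V)) : \bar R :=
  bc_complexity L' H.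

(* The valid halfspace H for P defines the facet F of conv P. *)
Definition defines_facet (P F H : set V) : Prop :=
  valid_halfspace U H P /\ F = conv_hull P `&` boundary H.

Definition facet_validity_complexity (P F : set V) (L' : seq (set V)) : \bar R :=
  ereal_inf [set validity_complexity H L' | H in defines_facet P F].

Definition facet_complexity (P : set V) (L' : seq (set V)) : \bar R :=
  ereal_sup [set facet_validity_complexity P F L' | F in facets (conv_hull P)].

End BranchAndCut.

(* Main.v *)
Require Import Defs.
From mathcomp Require Import all_boot all_order all_algebra.
From mathcomp Require Import all_classical all_reals all_analysis.
From mathcomp Require Import ring lra.
Import Order.TTheory GRing.Theory Num.Theory.
Import numFieldNormedType.Exports.
Local Open Scope classical_set_scope.
Local Open Scope ring_scope.
Set Implicit Arguments.
Unset Strict Implicit.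
Unset Printing Implicit Defensive.

(* Upper bound: choose for each facet F_i a defining halfspace H_i and a
   smallest tree T_i certifying it.  Branch successively on H_1 | H_1^c,
   H_2 | H_2^c, ...; below H_i^c copy T_i, whose leaves become empty because
   they lie in H_i.  The halfspace H_f needs no branching: T_f is copied
   directly below H_1, ..., H_(f-1), so f - 1 disjunctions suffice.  The
   remaining leaves lie in all the H_i, and the intersection of the H_i is
   contained in conv(P). *)

(** * Convexity, halfspaces and their boundaries *)

Section ConvexSets.
Variables (R : realType) (n : nat).
Local Notation V := 'rV[R]_n.
Implicit Types (A F G H : set V) (x y z p q : V).

(** The library notion takes weights packaged in an interval type; plain real weights with two
    inequalities suit [nra] and [lra]. *)
Lemma convexP A : convex A <->
  forall x y (s : R), A x -> A y -> 0 <= s -> s <= 1 -> A (s *: x + (1 - s) *: y).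
Proof.
split=> [cA x y s Ax Ay s0 s1|cA x y k /set_mem Ax /set_mem Ay].
  have hs : Itv.spec (@Itv.num_sem R) (Itv.Real `[0%Z, 1%Z]) s.
    by rewrite /= /Itv.num_sem /= num_real in_itv /= s0 s1.
  by have /set_mem := cA x y (Itv.mk hs) (mem_set Ax) (mem_set Ay).
by apply/mem_set; apply: (cA x y k%:num); rewrite // ?ge0 ?le1.
Qed.

Lemma convex_conv_hull A : convex (conv_hull A).
Proof.
apply/convexP => x y s cx cy s0 s1 B [cB AB].
by move/convexP: (cB); apply => //; [exact: cx|exact: cy].
Qed.

(** With [m = 1] this is a single functional, so constraint systems and face functionals share the
    same lemmas. *)
Definition lin (m : nat) (M : 'M[R]_(n, m)) x j : R := (x *m M) ord0 j.

Lemma lin_comb m (M : 'M[R]_(n, m)) (s u : R) x y j :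
  lin M (s *: x + u *: y) j = s * lin M x j + u * lin M y j.
Proof. by rewrite /lin mulmxDl -!scalemxAl !mxE. Qed.

Lemma lin_continuous m (M : 'M[R]_(n, m)) j : continuous (fun x => lin M x j).
Proof.
rewrite /lin.
have -> : (fun x : V => (x *m M) ord0 j) = (fun x => \sum_k x ord0 k * M k j).
  by apply/funext => x; rewrite mxE.
apply: continuous_big => [|k _]; first exact: add_continuous.
move=> x; apply: (@cvgMr_tmp _ _ (nbhs x) _ (fun y : V => y ord0 k)).
exact: coord_continuous.
Qed.

Lemma halfspace_le (c : 'cV[R]_n) (d : R) : halfspace [set x | lin c x ord0 <= d].
Proof.
split; apply/convexP => x y s /=; rewrite lin_comb; first by nra.
move=> /negP + /negP; rewrite -!ltNge => dx dy s0 s1; apply/negP; rewrite -ltNge.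
have [->|sn0] := eqVneq s 0; first by rewrite mul0r subr0 mul1r add0r.
have {}s0 : 0 < s by rewrite lt_def sn0.
nra.
Qed.

(** Since [c] is nonzero, some direction [v] has value 1 under it; a small move along [v] from a
    point with equality leaves the halfspace, so such a point is not interior. *)
Lemma boundary_le (c : 'cV[R]_n) (d : R) : c != 0 ->
  boundary [set x | lin c x ord0 <= d] = [set x | lin c x ord0 = d].
Proof.
move=> c0.
have [v v1] : exists v, lin c v ord0 = 1.
  have /cV0Pn[k ck] := c0.
  exists ((c k ord0)^-1 *: delta_mx ord0 k).
  by rewrite /lin -scalemxAl mxE -rowE mxE mulVf.
have cl : closed [set x | lin c x ord0 <= d].
  apply: (@preimage_closed _ _ (fun x => lin c x ord0) [set r : R | r <= d]).
    by move=> x _; exact: lin_continuous.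
  exact: closed_le.
have op : open [set x | lin c x ord0 < d].
  apply: (@open_comp _ _ (fun x => lin c x ord0) [set r : R | r < d]).
    by move=> x _; exact: lin_continuous.
  exact: open_lt.
rewrite /boundary -(closure_id _).1 //; apply/seteqP; split=> x /=.
  move=> [xd xi]; apply/eqP; rewrite eq_le xd /= leNgt; apply/negP => xd'; apply: xi.
  have : [set x | lin c x ord0 < d] `<=` [set x | lin c x ord0 <= d] by move=> y /ltW.
  by rewrite open_subsetE//; apply.
move=> xd; split; first by rewrite xd.
rewrite /interior /= => xn.
have : nbhs (0 : R) [set s | lin c (x + s *: v) ord0 <= d].
  have : (fun s : R => x + s *: v) @ (0 : R) --> x.
    rewrite -[X in _ --> X]addr0 -(scale0r v).
    by apply: cvgD; [exact: cvg_cst|apply: cvgZr_tmp; exact: cvg_id].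
  by move=> /(_ _ xn).
move=> /nbhs_ballP[e /= e0 /(_ (e / 2))].
rewrite /ball /= sub0r normrN ger0_norm; last lra.
have -> : x + (e / 2) *: v = 1 *: x + (e / 2) *: v by rewrite scale1r.
rewrite lin_comb v1 xd; lra.
Qed.

(* [y] is recovered near [q] as a combination of [z] and a point near [p]. *)
Lemma interior_segment H p z (s : R) : convex H -> interior H p -> H z ->
  0 < s -> s <= 1 -> interior H (s *: p + (1 - s) *: z).
Proof.
move=> /convexP cH Hp Hz s0 s1; rewrite /interior /=.
set q := _ + _.
have : (fun y => s^-1 *: (y - (1 - s) *: z)) @ q --> p.
  rewrite (_ : p = s^-1 *: (q - (1 - s) *: z)).
    apply: (@cvgZ _ _ _ (nbhs q) _ (fun=> s^-1)); first exact: cvg_cst.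
    apply: (@cvgB _ _ _ (nbhs q) _ id); [exact: cvg_id|exact: cvg_cst].
  by rewrite /q addrK scalerA mulVf ?scale1r ?gt_eqF.
move=> /(_ _ Hp); rewrite nbhs_filterE /=; apply: filterS => y /= Hy.
have -> : y = s *: (s^-1 *: (y - (1 - s) *: z)) + (1 - s) *: z.
  by rewrite scalerA mulfV ?scale1r ?subrK// gt_eqF.
by apply: cH => //; exact: ltW.
Qed.

End ConvexSets.

(** * Faces and facets of a polyhedron given by inequalities *)

Section Polyhedra.
Variables (R : realType) (n m : nat) (M : 'M[R]_(n, m)) (b : 'rV[R]_m).
Local Notation V := 'rV[R]_n.
Implicit Types (F G H : set V) (x y z p q : V).
Local Notation A := [set x : V | forall j, lin M x j <= b ord0 j].

Lemma convex_polyhedron : convex A.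
Proof.
apply/convexP => x y s /= Ax Ay s0 s1 j; rewrite lin_comb.
by have := Ax j; have := Ay j; nra.
Qed.

Lemma convex_face F : face A F -> convex F.
Proof.
move=> [c [d [_ ->]]]; apply/convexP => x y s [Ax xd] [Ay yd] s0 s1; split.
  by move: convex_polyhedron => /convexP; apply.
by rewrite /= -/(lin c _ ord0) lin_comb /lin xd yd; ring.
Qed.

(** Constraints are handled one at a time: the midpoint with a point strict at the new constraint
    keeps every strict inequality already gained. *)
Lemma slack_point F : F `<=` A -> convex F -> F !=set0 ->
  exists2 x, F x & forall j y, F y -> lin M y j < b ord0 j -> lin M x j < b ord0 j.
Proof.
move=> FA /convexP cF [x0 Fx0].
suff [x Fx xs] : exists2 x, F x & forall j, j \in enum 'I_m -> forall y, F y ->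
    lin M y j < b ord0 j -> lin M x j < b ord0 j.
  by exists x => // j; apply: xs; rewrite mem_enum.
elim: (enum 'I_m) => [|i s [x Fx xs]]; first by exists x0.
have [[y [Fy yi]]|noy] := pselect (exists y, F y /\ lin M y i < b ord0 i).
  exists (2^-1 *: x + (1 - 2^-1) *: y); first by apply: cF => //; lra.
  move=> j; rewrite in_cons => /orP[/eqP-> |js] y' Fy' y'j; rewrite lin_comb.
    by have := FA _ Fx i; lra.
  by have := FA _ Fy j; have := xs j js y' Fy' y'j; lra.
exists x => // j; rewrite in_cons => /orP[/eqP-> y Fy yi|js]; last exact: xs.
by case: noy; exists y.
Qed.

Definition tight F : {set 'I_m} :=
  [set j | `[< forall x, F x -> lin M x j = b ord0 j >]].

Lemma small_step (u v : 'I_m -> R) : (forall j, 0 < v j) ->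
  exists2 e, 0 < e & forall j, e * u j <= v j.
Proof.
(* The summand 1 keeps denominators positive; the initial value 1 keeps [e] positive even when [m]
   is 0. *)
move=> v0; pose e := \big[Num.min/1]_j (v j / (1 + `|u j|)).
have e0 : 0 < e by apply: lt_bigmin => // j _; rewrite divr_gt0// ltr_pwDl.
exists e => // j; apply: (@le_trans _ _ (e * (1 + `|u j|))).
  by rewrite ler_pM2l// (le_trans (ler_norm _))// lerDr.
by rewrite -ler_pdivlMr ?ltr_pwDl//; exact: bigmin_le.
Qed.

(* A face has a point where only its tight constraints are tight; moving from
   it slightly away from [x] stays in the polyhedron, so [x] must attain the
   maximum defining the face. *)
Lemma face_tight F x : face A F -> F !=set0 -> A x ->
  (forall j, j \in tight F -> lin M x j = b ord0 j) -> F x.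
Proof.
move=> fF F0 Ax xt; have cF := convex_face fF.
have FA : F `<=` A by case: fF => c [d [_ ->]] y [].
have [y Fy ys] := slack_point FA cF F0.
case: fF => c [d [Ad FE]].
(* Off the tight constraints, [v] is the slack at [y] and [u] the growth per unit step away from
   [x]; on tight ones the values 1 and 0 impose nothing on [e]. *)
pose v j := if j \in tight F then 1 else b ord0 j - lin M y j.
pose u j := if j \in tight F then 0 else lin M y j - lin M x j.
have [j|e e0 eu] := @small_step u v.
  rewrite /v; case: ifPn => //; rewrite inE => /asboolPn/existsNP[y' /not_implyP[Fy' y'j]].
  by rewrite subr_gt0; apply: (ys j y') => //; rewrite lt_neqAle; have := FA _ Fy' j => /= ->; case: eqP y'j.
have : A ((1 + e) *: y + (- e) *: x).
  move=> j /=; rewrite lin_comb; have := eu j; rewrite /u /v.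
  case: ifPn => [jt _|_]; last by lra.
  rewrite (xt j jt); move: jt; rewrite inE => /asboolP/(_ _ Fy) ->; lra.
move=> /Ad; rewrite -/(lin c _ ord0) lin_comb.
have yd : lin c y ord0 = d by move: Fy; rewrite FE => -[].
have xd : lin c x ord0 <= d by exact: Ad.
rewrite yd => h; rewrite FE; split=> //=.
by apply/eqP; rewrite eq_le -/(lin c x ord0) xd /=; nra.
Qed.

(** Enlarging a face can only lose tight constraints. A proper face above [F] with the fewest of
    them is maximal, because by [face_tight] a larger face with the same tight set is equal to
    it. *)
Lemma sub_facet F : proper_face A F -> exists2 G, facets A G & F `<=` G.
Proof.
move=> pF.
pose Q k := `[< exists G, [/\ proper_face A G, F `<=` G & #|tight G| = k] >].
have exQ : exists k, Q k by exists #|tight F|; apply/asboolP; exists F; split.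
case: (ex_minnP exQ) => k /asboolP[G [pG FG <-]] minG.
exists G => //; split=> // G' pG' GG'.
apply/seteqP; split=> // x G'x.
have sub : tight G' \subset tight G.
  apply/fintype.subsetP => j; rewrite !inE => /asboolP tG'; apply/asboolP => y Gy.
  exact/tG'/GG'.
have /eqP tE : tight G' == tight G.
  rewrite eqEcard sub /=; apply: minG; apply/asboolP; exists G'; split=> //.
  exact: subset_trans GG'.
have [fG' _ _] := pG'; have [fG G0 _] := pG.
apply: face_tight => //; first by case: fG' G'x => c [d [_ ->]] [].
by move=> j; rewrite -tE inE => /asboolP; apply.
Qed.

Lemma lin_col x j : lin (col j M) x ord0 = lin M x j.
Proof. by rewrite /lin !mxE; apply: eq_bigr => k _; rewrite mxE. Qed.

(** The differences of [n + 1] affinely independent points of the polyhedron form an invertible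
    matrix that annihilates column [j]. *)
Lemma full_dimensional_tight j : full_dimensional A ->
  (forall x, A x -> lin M x j = b ord0 j) -> forall x, lin M x j = 0.
Proof.
move=> [x [xi xA]] tj.
have Mj : col j M = 0.
  move: xi; rewrite /affinely_independent row_free_unit; set X := \matrix_(_ < _) _ => Xu.
  rewrite -(mulKmx Xu (col j M)) (_ : X *m col j M = 0) ?mulmx0//.
  apply/row_matrixP => i; rewrite row_mul rowK.
  apply/rowP => k; rewrite mulmxBl !mxE.
  have := tj _ (xA (lift ord0 i)); have := tj _ (xA ord0).
  rewrite -!lin_col /lin !mxE (ord1 k) => -> ->; exact: subrr.
by move=> y; rewrite -lin_col Mj /lin mulmx0 mxE.
Qed.

(* [s] is the weight of [p] at the last point of the segment from [p] to [z]
   that is still in the polyhedron. *)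
Lemma exit_point p z : A p -> ~ A z ->
  (forall j, b ord0 j < lin M z j -> lin M p j < b ord0 j) ->
  exists s j, [/\ 0 < s, s <= 1, A (s *: p + (1 - s) *: z),
    lin M (s *: p + (1 - s) *: z) j = b ord0 j & lin M p j < b ord0 j].
Proof.
move=> Ap /existsNP[j0 /negP]; rewrite -ltNge => j0z ps.
(* The weight of [p] at which constraint [j] becomes an equality. The largest such weight among the
   constraints violated at [z] belongs to the first one met from [p]. *)
pose r j := (lin M z j - b ord0 j) / (lin M z j - lin M p j).
case: (@arg_maxP _ _ _ j0 (fun j => b ord0 j < lin M z j) r j0z) => j jz jmax.
have pj := ps j jz.
have rE i : b ord0 i < lin M z i -> r i * (lin M z i - lin M p i) = lin M z i - b ord0 i.
  by move=> iz; rewrite /r divfK// subr_eq0 gt_eqF// (lt_trans (ps _ iz)).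
have r0 : 0 < r j by rewrite divr_gt0 ?subr_gt0// (lt_trans pj).
have r1 : r j <= 1.
  by rewrite ler_pdivrMr ?subr_gt0 ?(lt_trans pj)// mul1r lerD2l lerN2 ltW.
exists (r j), j; split=> // [i /=|]; rewrite lin_comb; last by have := rE j jz; lra.
have [iz|iz] := ltP (b ord0 i) (lin M z i); last by have := Ap i; nra.
have := jmax i iz => /= rij; have := rE i iz; have := ps i iz; nra.
Qed.

(* Let [q] be the point where a segment from an interior point [p] to a point
   [z] outside leaves the polyhedron; it lies on a facet.  A convex set [H]
   that contains the polyhedron and [z] has [q] in its interior, so [H] does
   not define that facet. *)
Lemma facet_halfspaces_sub z : full_dimensional A ->
  (forall F, facets A F ->
    exists H, [/\ convex H, A `<=` H, F = A `&` boundary H & H z]) -> A z.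
Proof.
move=> fd fH; apply: contrapT => nAz.
have A0 : A !=set0 by have [x [_ xA]] := fd; exists (x ord0).
have [p Ap ps] := slack_point (@subset_refl _ A) convex_polyhedron A0.
(* Full dimension leaves only identically vanishing constraints without slack at [p], which makes
   [p] an interior point. *)
have {}ps j : lin M p j < b ord0 j \/ forall x, lin M x j = 0.
  have [[y [Ay yj]]|noy] := pselect (exists y, A y /\ lin M y j < b ord0 j).
    by left; exact: (ps j y).
  right; apply: full_dimensional_tight => // x Ax; apply/eqP.
  by rewrite eq_le Ax /= leNgt; apply/negP => xj; apply: noy; exists x.
have psz j : b ord0 j < lin M z j -> lin M p j < b ord0 j.
  by case: (ps j) => // z0; rewrite z0 => bj; have := Ap j; rewrite z0 leNgt bj.
have [s [j [s0 s1]]] := exit_point Ap nAz psz.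
set q := _ + _ => Aq qj pj.
(* The constraint met at [q] is strict at [p], so its face is proper. *)
have pF : proper_face A (A `&` [set x | lin (col j M) x ord0 = b ord0 j]).
  split.
  - by exists (col j M), (b ord0 j); split=> // x Ax; rewrite -/(lin _ _ ord0) lin_col.
  - by exists q; split=> //=; rewrite lin_col.
  - move=> /seteqP[_ /(_ p Ap)][_ /=]; rewrite lin_col => pj'.
    by move: pj; rewrite pj' ltxx.
have [G fG FG] := sub_facet pF.
have [H [cH AH GE Hz]] := fH _ fG.
have : G q by apply: FG; split=> //=; rewrite lin_col.
rewrite GE => -[_ [_]]; apply; apply: interior_segment => //.
rewrite /interior /=.
have : \forall x \near p, forall j, lin M x j <= b ord0 j.
  apply: (@filter_forall _ _ _ (nbhs p)) => k; case: (ps k) => [pk|k0].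
    have := @lin_continuous _ _ _ M k p; move=> /(_ _ (lt_nbhsl pk)).
    by apply: (@filterS _ (nbhs p)) => x /ltW.
  by apply: nearW => x; rewrite k0 -(k0 p).
by apply: filterS => x Ax; apply: AH.
Qed.

End Polyhedra.

(** * Grafting and combining branch-and-cut trees *)

Section Trees.
Variables (R : realType) (n : nat).
Local Notation V := 'rV[R]_n.
Variables (U : set V) (ck : checker U) (ck_mono : subsystem_monotone ck).
Variables (disjs : set (seq (set V))) (cuts : set (set V)).
Implicit Types (L : seq (set V)) (G H X : set V).

Lemma interP L x : inter L x <-> forall G, G \in L -> G x.
Proof.
rewrite /inter; elim: L => [|G L IH]; first by rewrite big_nil.
rewrite big_cons; split=> [[Gx Lx] H|GLx].
  by rewrite in_cons => /orP[/eqP->//|]; exact: IH.1.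
split; first by apply: GLx; rewrite mem_head.
by apply/IH => H HL; apply: GLx; rewrite in_cons HL orbT.
Qed.

Lemma inter_subseq L L2 : subseq L L2 -> inter L2 `<=` inter L.
Proof.
by move=> /mem_subseq s x /interP L2x; apply/interP => G /s; exact: L2x.
Qed.

Lemma subseq_rcons2 (T : eqType) (s1 s2 : seq T) x :
  subseq s1 s2 -> subseq (rcons s1 x) (rcons s2 x).
Proof. by move=> s12; rewrite -!cats1; exact: cat_subseq. Qed.

Lemma subseq_leaf_labels L (t : bctree V) l : leaf_labels L t l -> subseq L l.
Proof.
elim: t L => [ow|p D ch IH|G w t IH] L /=; first by move=> ->.
  by move=> [i /IH]; apply/subseq_trans/subseq_rcons.
by move=> /IH; apply/subseq_trans/subseq_rcons.
Qed.

Lemma convex_rcons L G : (forall H, H \in L -> convex H) -> convex G ->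
  forall H, H \in rcons L G -> convex H.
Proof. by move=> cL cG H; rewrite mem_rcons in_cons => /orP[/eqP->|/cL]. Qed.

(** Validity survives a larger root label: the intersection that a cut must contain shrinks, and
    [ck_mono] replaces each cutting plane certificate by one of at most the same length. *)
Lemma graft (t : bctree V) L L2 : bcvalid ck disjs cuts L t -> subseq L L2 ->
  (forall G, G \in L2 -> convex G) ->
  exists t', [/\ bcvalid ck disjs cuts L2 t', (bcsize t' <= bcsize t)%N
    & forall l, leaf_labels L2 t' l -> exists2 l0, leaf_labels L t l0 & subseq l0 l].
Proof.
elim: t L L2 => [ow|p D ch IH|G w t IH] L L2 /=.
- by move=> _ sL cL; exists (Leaf None); split=> //= l ->; exists L.
- move=> [vD dD vch] sL cL.
  have /choice[ch' chP] i := IH i _ _ (vch i) (subseq_rcons2 _ sL)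
    (convex_rcons cL (vD.1 _ (mem_tnth i D))).
  exists (Disj D ch'); split=> /=.
  + by split=> // i; have [] := chP i.
  + by rewrite leq_add2l; apply: leq_sum => i _; have [] := chP i.
  + move=> l [i]; have [_ _ /[apply] -[l0 ? ?]] := chP i.
    by exists l0 => //; exists i.
- move=> [[[cG cGc] GP] cutG acc vt] sL cL.
  have [t' [vt' st' lt']] := IH _ _ vt (subseq_rcons2 G sL) (convex_rcons cL cG).
  have hL2 : forall B, B \in rcons (restrictions U L2) (U `\` G) -> helly_family U B.
    move=> B; rewrite mem_rcons in_cons => /orP[/eqP->|/mapP[C CL ->]].
      by exists (~` G); rewrite // setIC.
    by exists C => //; exact: cL.
  have [w' acc' sw'] := ck_mono hL2 (subseq_rcons2 _ (map_subseq _ sL)) acc.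
  exists (Cut G w' t'); split=> /=; last exact: lt'.
  + split=> //; split=> //; apply: subset_trans GP.
    by apply: setIS; exact: inter_subseq.
  + by rewrite leq_add// leq_add2l.
Qed.

Definition certifies L H (t : bctree V) :=
  bcvalid ck disjs cuts L t /\ forall l, leaf_labels L t l -> inter l `<=` H.

Hypothesis simple_disjs : forall H, halfspace H -> disjs [:: H; ~` H].

Lemma certifies_simple_disj L H X (t1 t2 : bctree V) : halfspace H ->
  certifies (rcons L H) X t1 -> certifies (rcons L (~` H)) X t2 ->
  exists2 t, certifies L X t & bcsize t = (bcsize t1 + bcsize t2).+1.
Proof.
move=> hH [v1 l1] [v2 l2].
exists (Disj [tuple H; ~` H] (fun i => if i == ord0 then t1 else t2)).
  split=> [/=|l /= [i]].
    split; last 2 first.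
    - exact: simple_disjs.
    - by move=> i; case: ifPn => [/eqP->//|]; case: i => -[|[|]].
    split=> [B|]; first by rewrite !inE => /orP[]/eqP->; case: hH.
    by rewrite !big_cons big_nil setU0 -setIUl setUv setTI.
  by case: ifPn => [/eqP->|]; [exact: l1|case: i => -[|[|]] // ? _; exact: l2].
by rewrite /= !big_ord_recl big_ord0 addn0.
Qed.

(** [L2] is [L] enlarged by the halfspaces already branched on. The index list is nonempty so that
    the induction ends in a bare graft; one disjunction is thus saved, whence the strict bound. *)
Lemma certifies_halfspaces (I : eqType) L L2 (h : I -> set V)
    (T : I -> bctree V) i (s : seq I) :
  (forall j, j \in i :: s -> halfspace (h j) /\ certifies L (h j) (T j)) ->
  subseq L L2 -> (forall G, G \in L2 -> convex G) ->
  exists2 t, certifies L2 [set z | forall j, j \in i :: s -> h j z] t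
    & (bcsize t < \sum_(j <- i :: s) (bcsize (T j)).+1)%N.
Proof.
elim: s i L2 => [|i' s IH] i L2 sP sL cL2.
  have [_ [vi li]] := sP i (mem_head _ _).
  have [t [vt st lt]] := graft vi sL cL2.
  exists t; last by rewrite big_seq1.
  split=> // l /lt[l0 /li li0 /inter_subseq ll0] z /ll0/li0 ?.
  by move=> j; rewrite inE => /eqP->.
have [hi [vi li]] := sP i (mem_head _ _).
have [t1 [v1 l1] s1] := IH i' (rcons L2 (h i))
  (fun j js => sP j (mem_behead (s := i :: _) js))
  (subseq_trans sL (subseq_rcons _ _)) (convex_rcons cL2 hi.1).
have [t2 [v2 s2 l2]] := graft vi (subseq_trans sL (subseq_rcons L2 (~` h i)))
  (convex_rcons cL2 hi.2).
have [|||t ct st] := @certifies_simple_disj L2 (h i)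
    [set z | forall j, j \in [:: i, i' & s] -> h j z] t1 t2 => //.
- split=> // l ll z lz j; rewrite in_cons => /orP[/eqP->|]; last exact: (l1 l).
  move/interP: lz; apply; apply: (mem_subseq (subseq_leaf_labels ll)).
  by rewrite mem_rcons mem_head.
- split=> // l ll z lz; have [l0 /li li0 /inter_subseq ll0] := l2 l ll.
  have : (~` h i) z; last by move/(_ (li0 _ (ll0 _ lz))).
  move/interP: lz; apply; apply: (mem_subseq (subseq_leaf_labels ll)).
  by rewrite mem_rcons mem_head.
exists t => //; rewrite st big_cons addSn ltnS addnC -addnS.
exact: leq_add.
Qed.

End Trees.

(** * Comparing and attaining complexities *)

Section Complexities.
Variables (R : realType) (n : nat).
Local Notation V := 'rV[R]_n.
Variables (U : set V) (ck : checker U).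
Variables (disjs : set (seq (set V))) (cuts : set (set V)).
Implicit Types (L : seq (set V)) (F H P X : set V).

Lemma conv_hull_sub P H : convex H -> P `<=` H -> conv_hull P `<=` H.
Proof. exact: smallest_sub. Qed.

Lemma facet_halfspace P F : P `<=` U -> facets (conv_hull P) F ->
  exists H, defines_facet U P F H.
Proof.
move=> PU [[[c [d [Ad FE]]] [x Fx] FA] _].
exists [set x | lin c x ord0 <= d]; split.
  split; first exact: halfspace_le.
  by move=> y Py; split; [apply: Ad; exact: (sub_smallest (@subset_refl _ P))|exact: PU].
(* With [c = 0], nonemptiness of [F] would force [d = 0], and the face would be the whole hull. *)
rewrite boundary_le //; apply: contra_notN FA => /eqP c0.
rewrite FE; apply/seteqP; split=> [y []//|y Ay]; split=> //=.
by move: Fx; rewrite FE c0 => -[_ /=]; rewrite !mulmx0.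
Qed.

Lemma certifies_bc_complexity L X (t : bctree V) : certifies ck disjs cuts L X t ->
  (bc_complexity ck disjs cuts L X <= (bcsize t)%:R%:E)%E.
Proof. by move=> tX; apply: ereal_inf_lbound; exists t. Qed.

Lemma bc_complexity_sub L X X' : X `<=` X' ->
  (bc_complexity ck disjs cuts L X' <= bc_complexity ck disjs cuts L X)%E.
Proof.
move=> XX'; apply: ereal_inf_le_tmp => _ [t [vt lt] <-]; exists t => //.
by split=> // l /lt /subset_trans; apply.
Qed.

(** Tree sizes are natural numbers, so the double infimum over halfspaces and trees is a minimum
    once some tree exists. *)
Lemma facet_validity_attained P F L :
  (facet_validity_complexity ck disjs cuts P F L < +oo)%E ->
  exists H t, [/\ defines_facet U P F H, certifies ck disjs cuts L H t
    & ((bcsize t)%:R%:E <= facet_validity_complexity ck disjs cuts P F L)%E].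
Proof.
pose Q k := `[< exists H t, [/\ defines_facet U P F H,
  certifies ck disjs cuts L H t & bcsize t = k] >].
have lb (e : \bar R) : (forall k, Q k -> (e <= k%:R%:E)%E) ->
    (e <= facet_validity_complexity ck disjs cuts P F L)%E.
  move=> eQ; apply/ereal_infP => _ [H HF <-]; apply/ereal_infP => _ [t tH <-].
  by apply: eQ; apply/asboolP; exists H, t.
have [exQ _|nQ] := pselect (exists k, Q k).
  case: (ex_minnP exQ) => k /asboolP[H [t [HF tH tk]]] mink.
  exists H, t; split=> //; apply: lb => k' Qk'.
  by rewrite lee_fin ler_nat tk mink.
(* Without any tree, [+oo] is a lower bound, contradicting finiteness. *)
by rewrite ltNge lb// => k Qk; case: nQ; exists k.
Qed.

End Complexities.

Theorem theorem4p5 (R : realType) (n : nat) (U : set 'rV[R]_n)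
    (ck : checker U) (ck_mono : subsystem_monotone ck)
    (disjs : set (seq (set 'rV[R]_n))) (cuts : set (set 'rV[R]_n))
    (simple_disjs : forall H : set 'rV[R]_n, halfspace H -> disjs [:: H; ~` H])
    (t : nat) (K K' : 'I_t -> set 'rV[R]_n)
    (K_family : forall i, helly_family U (K i))
    (K'_relax : forall i, relaxation U (K i) (K' i))
    (P : set 'rV[R]_n) (P_family : helly_family U P) (P_def : P = \bigcap_i K i)
    (PI_polyhedron : polyhedron (conv_hull P))
    (PI_full_dim : full_dimensional (conv_hull P))
    (f : nat) (f_def : (facets (conv_hull P) #= `I_f)%card) :
  let L' := [seq K' i | i <- enum 'I_t] in
  (facet_complexity ck disjs cuts P L' <= hull_complexity ck disjs cuts P L')%E
  /\
  ((0 < f)%N ->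
   (hull_complexity ck disjs cuts P L'
      <= (f%:R)%:E * (facet_complexity ck disjs cuts P L' + 1))%E).
Proof.
move=> L'.
have PU : P `<=` U by case: P_family => C _ <- x [].
have L'_convex G : G \in L' -> convex G by move=> /mapP[i _ ->]; have [] := K'_relax i.
split.
  apply: ge_ereal_sup => _ [F fF <-].
  have [H HF] := facet_halfspace PU fF.
  apply: (@le_trans _ _ (validity_complexity ck disjs cuts H L')).
    by apply: ereal_inf_lbound; exists H.
  (* A defining halfspace is convex and contains [P], hence the hull, so every tree for the hull
     also certifies it. *)
  have [[[cH _] PH] _] := HF.
  by apply: bc_complexity_sub; apply: conv_hull_sub => // x /PH[].
move=> f0; set fc := facet_complexity _ _ _ _ _.
have [fcy|] := eqVneq fc +oo%E.
  by rewrite fcy addye// gt0_muley ?leey// lte_fin ltr0n.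
rewrite -ltey => fc_fin.
have /card_set_bijP[g [g_facet _ g_surj]] : (`I_f #= facets (conv_hull P))%card.
  by rewrite card_eq_sym.
have /choice[Ht HtP] i : exists Ht : set 'rV[R]_n * bctree 'rV[R]_n, (i < f)%N ->
    [/\ defines_facet U P (g i) Ht.1, certifies ck disjs cuts L' Ht.1 Ht.2
      & ((bcsize Ht.2)%:R%:E <= fc)%E].
  (* Indices from [f] on get a dummy value so that choice yields a total function. *)
  have [fi|] := ltnP i f; last by exists (set0, Leaf None).
  have vc_le : (facet_validity_complexity ck disjs cuts P (g i) L' <= fc)%E.
    by apply: ereal_sup_ubound; exists (g i) => //; exact: g_facet.
  have [H [T [HF TH Tle]]] := facet_validity_attained (le_lt_trans vc_le fc_fin).
  by exists (H, T) => _; split=> //; exact: le_trans vc_le.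
(* The tree for facet 0, available as [f] is positive, bounds [fc] below and excludes [-oo]. *)
have [r fcE] : exists r, fc = r%:E.
  have [_ _] := HtP 0%N f0.
  by move: fc_fin; case: (fc) => [r||]//; exists r.
have iotaE : 0%N :: iota 1 f.-1 = iota 0 f by case: (f) f0.
have [|t' [vt' lt'] st'] := @certifies_halfspaces _ _ _ _ ck_mono _ cuts simple_disjs _
  L' L' (fst \o Ht) (snd \o Ht) 0%N (iota 1 f.-1) _ (subseq_refl _) L'_convex.
  move=> j; rewrite iotaE mem_iota add0n => /andP[_ /HtP[[[hH _] _] cH _]].
  by split.
apply: (@le_trans _ _ (bcsize t')%:R%:E).
  (* A leaf point lies in one defining halfspace per facet, so [facet_halfspaces_sub] places it in
     the hull. *)
  apply: certifies_bc_complexity; split=> // l /lt' /subset_trans; apply => z /= Hz.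
  have [m [M [b]]] := PI_polyhedron.
  rewrite -[X in _ = X -> _]/[set x | forall j, lin M x j <= b ord0 j] => PE.
  rewrite PE; move: PI_full_dim; rewrite PE => /facet_halfspaces_sub; apply.
  rewrite -PE => F /g_surj[i fi <-].
  have [[[[cH _] PH] gE] _ _] := HtP i fi; exists (Ht i).1; split=> //.
  - by apply: conv_hull_sub => // x /PH[].
  - by apply: Hz; rewrite iotaE mem_iota add0n.
rewrite fcE -EFinD -EFinM lee_fin.
apply: (@le_trans _ _ (\sum_(j <- iota 0 f) (bcsize (Ht j).2).+1)%:R).
  by rewrite ler_nat -iotaE ltnW.
rewrite natr_sum.
(* Each tree has size at most [r]; the extra 1 pays for its disjunction node. *)
apply: (@le_trans _ _ (\sum_(j <- iota 0 f) (r + 1))).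
  rewrite big_seq [leRHS]big_seq; apply: ler_sum => j.
  rewrite mem_iota add0n => /HtP[_ _]; rewrite fcE lee_fin -natr1 => ?.
  by rewrite lerD2r.
by rewrite big_const_seq count_predT size_iota iter_addr_0 mulr_natl.
Qed.
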